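(* Let $\mathbb{V}$ be a real Hilbert space, let $g\colon\mathbb{R}^m\to\mathbb{R}\cup\{\infty\}$ be a proper convex lower semi-continuous function, and let $f(\mathbf{x}) = g(A\mathbf{x})$ for $\mathbf{x}\in\mathbb{V}$, where $A\colon\mathbb{V}\to\mathbb{R}^m$ is a linear transformation satisfying $A^\top A=\alpha\,\mathrm{Id}$ for some constant $\alpha>0$. Define the approximal operator $\mathrm{approx}_f\colon\mathbb{V}\to\mathbb{V}$ by $$\mathrm{approx}_{f}(\mathbf{x}) = \alpha^{-1}A^\top\left(\mathrm{proj}_{\mathcal{R}(A)}\left(\mathrm{prox}_{\alpha g}(A\mathbf{x})\right)\right).$$ Then for all $\mathbf{x}\in\mathbb{V}$, $$\mathrm{approx}_{f}(\mathbf{x}) = \alpha^{-1}A^\top\mathrm{prox}_{\alpha g}(A\mathbf{x}),$$ and $\mathrm{approx}_f$ is the proximal operator of some convex lower semi-continuous function, i.e. there exists a convex lower semi-continuous function $\phi\colon\mathbb{V}\to\mathbb{R}\cup\{\infty\}$ such that $\mathrm{approx}_f=\mathrm{prox}_\phi$.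
   Context: Norms are those induced by the inner products: $\mathbb{R}^m$ carries the standard Euclidean inner product, and $A^\top\colon\mathbb{R}^m\to\mathbb{V}$ denotes the adjoint of $A$. $\mathrm{Id}$ is the identity on $\mathbb{V}$ (so $A$ is injective and $\mathbb{V}$ is finite-dimensional). $\mathcal{R}(A)\subset\mathbb{R}^m$ is the range of $A$ and $\mathrm{proj}_{\mathcal{R}(A)}$ is the orthogonal projection of $\mathbb{R}^m$ onto it. For a convex lower semi-continuous function $h\colon\mathbb{H}\to\mathbb{R}\cup\{\infty\}$ on a Hilbert space $\mathbb{H}$, the proximal operator $\mathrm{prox}_h\colon\mathbb{H}\to\mathbb{H}$ maps $\mathbf{x}$ to the unique minimizer of $\mathbf{u}\mapsto h(\mathbf{u})+\tfrac12\|\mathbf{u}-\mathbf{x}\|^2$ over $\mathbb{H}$ (which exists and is unique when $h$ is proper). *)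

(* Defs.v *)
From HB Require Import structures.
From mathcomp Require Import all_boot all_order all_algebra.
From mathcomp Require Import all_classical all_reals all_analysis.
From mathcomp Require Import sesquilinear.
Import Order.TTheory GRing.Theory Num.Theory numFieldNormedType.Exports.

Set Implicit Arguments.
Unset Strict Implicit.
Unset Printing Implicit Defensive.

Local Open Scope classical_set_scope.
Local Open Scope ring_scope.

(* The norm that the library puts on 'rV[R]_m is the sup norm. Only the topology
   it induces, which is also the Euclidean one, is used below; lengths and angles
   in R^m are always measured with [eucl]. *)
Section eucl.
Context {R : realType} {m : nat}.

Definition eucl (u v : 'rV[R]_m) : R := \sum_(i < m) u 0 i * v 0 i.

Fact eucl_linearl (v : 'rV[R]_m) : linear_for *%R (eucl ^~ v).
Proof.
move=> a x y; rewrite /eucl mulr_sumr -big_split; apply: eq_bigr => i _ /=.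
by rewrite !mxE mulrDl mulrA.
Qed.

Fact eucl_linearr (u : 'rV[R]_m) : linear_for (idfun \; *%R) (eucl u).
Proof.
move=> a x y; rewrite /eucl /= mulr_sumr -big_split; apply: eq_bigr => i _ /=.
by rewrite !mxE mulrDr mulrCA.
Qed.

HB.instance Definition _ := bilinear_isBilinear.Build R _ _ R
  *%R (idfun \; *%R) eucl (eucl_linearl, eucl_linearr).

Fact eucl_sym (u v : 'rV[R]_m) : eucl u v = (-1) ^+ false * idfun (eucl v u).
Proof. by rewrite mul1r; apply: eq_bigr => i _; rewrite mulrC. Qed.

HB.instance Definition _ :=
  isHermitianSesquilinear.Build R _ false idfun eucl eucl_sym.

Fact eucl_gt0 (u : 'rV[R]_m) : u != 0 -> 0 < eucl u u.
Proof.
move=> u0; rewrite lt_neqAle sumr_ge0 ?andbT => [|i _]; last by rewrite -expr2 sqr_ge0.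
apply: contra u0; rewrite eq_sym psumr_eq0 => [/allP u0|i _]; last by rewrite -expr2 sqr_ge0.
apply/eqP/rowP => i; rewrite mxE; apply/eqP.
by have := u0 i (mem_index_enum _); rewrite mulf_eq0 orbb.
Qed.

HB.instance Definition _ := isDotProduct.Build R _ eucl eucl_gt0.

End eucl.

Section extended_real_functions.
Context {R : realType} {H : lmodType R}.
Implicit Types h : H -> \bar R.
Local Open Scope ereal_scope.

(* The sum on the right is never of the form +oo - oo when h avoids -oo, which
   [eproper] guarantees; at t = 0 and t = 1 the convention 0 * +oo = 0 makes the
   inequality trivially true. *)
Definition econvex h := forall (x y : H) (t : R), (0 <= t <= 1)%R ->
  h (t *: x + (1 - t) *: y)%R <= t%:E * h x + (1 - t)%:E * h y.

Definition eproper h := (forall x, h x != -oo) /\ (exists x, h x != +oo).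

Definition argmin h : set H := [set p | forall u, h p <= h u].

End extended_real_functions.

(* The three operators below are total functions: [xget 0 P] is an element of P
   if there is one, and 0 otherwise. *)
Section operators.
Context {R : realType}.

Definition prox {H : lmodType R} (dot : {dot H for idfun}) (h : H -> \bar R)
    (x : H) : H :=
  xget 0 (argmin (fun u => h u + (2^-1 * dot (u - x) (u - x))%:E)%E).

Definition orthoproj {H : lmodType R} (dot : {dot H for idfun}) (S : set H)
    (x : H) : H :=
  xget 0 [set p | S p /\ forall s, S s -> dot (x - p) s = 0].

(* For linear A, if [adjoint dotV dotW A (A x) = a *: x] for all x, with a > 0,
   then the default value is never involved for x != 0, and therefore
   [dotW (A z) (A x) = a * dotV z x]. Hence A is a multiple of an isometry, and
   the true adjoint exists when V is complete. *)
Definition adjoint {V W : lmodType R} (dotV : {dot V for idfun})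
    (dotW : {dot W for idfun}) (A : V -> W) (y : W) : V :=
  xget 0 [set v | forall x, dotW (A x) y = dotV x v].

Definition approximal {V : lmodType R} (dot : {dot V for idfun}) {m : nat}
    (A : V -> 'rV[R]_m) (alpha : R) (g : 'rV[R]_m -> \bar R) (x : V) : V :=
  alpha^-1 *: adjoint dot eucl A
    (orthoproj eucl (range A) (prox eucl (fun z => alpha%:E * g z)%E (A x))).

End operators.

(* Main.v *)
(* Let phi v be the infimum of g u + |u - A v|^2 / (2 alpha) over the u with
   A^T u = alpha v, that is, over the u such that u - A v is orthogonal to the
   range of A.  For such u, Pythagoras gives
     |u - A x|^2 = |u - A v|^2 + alpha |v - x|^2,
   so minimising phi v + |v - x|^2 / 2 over v amounts to minimising
   g u + |u - A x|^2 / (2 alpha) over all u: the minimiser is v = A^T u / alpha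
   with u = prox_{alpha g} (A x).  Convexity of phi is that of an infimal
   projection; lower semicontinuity follows from the compactness of balls of R^m,
   because g has an affine minorant and the quadratic term is coercive.
   Minimisers (for prox_{alpha g}, and for the adjoint of A as a least-squares
   solution) exist because minimising sequences of a strongly convex function
   are Cauchy. *)
Require Import Defs.
From HB Require Import structures.
From mathcomp Require Import all_boot all_order all_algebra.
From mathcomp Require Import all_classical all_reals all_analysis.
From mathcomp Require Import sesquilinear.
From mathcomp Require Import ring lra.
Import Order.TTheory GRing.Theory Num.Theory numFieldNormedType.Exports.

Local Open Scope classical_set_scope.
Local Open Scope ring_scope.

(** * Inner product identities and inequalities *)

Section dot_product.
Context {R : realType} {H : lmodType R} (dot : {dot H for idfun}).
Implicit Types x y z : H.

Lemma dotC x y : dot x y = dot y x.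
Proof. by rewrite hermC expr0 mul1r. Qed.

Lemma dotDl x y z : dot (x + y) z = dot x z + dot y z.
Proof. exact: linearDl. Qed.

Lemma dotDr x y z : dot z (x + y) = dot z x + dot z y.
Proof. exact: linearDr. Qed.

Lemma dotNl x z : dot (- x) z = - dot x z.
Proof. exact: linearNl. Qed.

Lemma dotNr x z : dot z (- x) = - dot z x.
Proof. exact: linearNr. Qed.

Lemma dotZl a x z : dot (a *: x) z = a * dot x z.
Proof. exact: linearZl_LR. Qed.

Lemma dotZr a x z : dot z (a *: x) = a * dot z x.
Proof. exact: linearZr_LR. Qed.

Definition dotE := (dotDl, dotDr, dotNl, dotNr, dotZl, dotZr).

Lemma dot_eq0 x : dot x x = 0 -> x = 0.
Proof.
move=> x0; apply/eqP/negPn/negP => x1.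
have := neq0_dnorm_gt0 x x1 : 0 < dot x x.
by rewrite x0 ltxx.
Qed.

Lemma dot_ge0 x : 0 <= dot x x.
Proof.
have [->|x0] := eqVneq x 0; first by rewrite linear0l.
exact/ltW/neq0_dnorm_gt0.
Qed.

Lemma dot_inj x y : (forall z, dot z x = dot z y) -> x = y.
Proof.
by move=> xy; apply/subr0_eq/dot_eq0; rewrite dotDr dotNr xy subrr.
Qed.

Lemma dot_convex x y (t : R) : 0 <= t <= 1 ->
  dot (t *: x + (1 - t) *: y) (t *: x + (1 - t) *: y) <=
  t * dot x x + (1 - t) * dot y y.
Proof.
move=> /andP[t0 t1]; rewrite -subr_ge0.
have -> : t * dot x x + (1 - t) * dot y y -
    dot (t *: x + (1 - t) *: y) (t *: x + (1 - t) *: y) =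
    t * (1 - t) * dot (x - y) (x - y).
  by rewrite !dotE (dotC y x); ring.
by rewrite mulr_ge0 ?dot_ge0// mulr_ge0// subr_ge0.
Qed.

Lemma dot_parallelogram x y z :
  dot (2^-1 *: (x + y) - z) (2^-1 *: (x + y) - z) +
  4^-1 * dot (x - y) (x - y) =
  2^-1 * dot (x - z) (x - z) + 2^-1 * dot (y - z) (y - z).
Proof. by rewrite !dotE (dotC y x) (dotC z x) (dotC z y); field. Qed.

Lemma dot_pythagoras x y :
  dot x y = 0 -> dot (x + y) (x + y) = dot x x + dot y y.
Proof. by move=> xy; rewrite !dotE (dotC y x) xy addr0 add0r. Qed.

Lemma dot_stationary x z :
  (forall t, dot x x <= dot (x + t *: z) (x + t *: z)) -> dot z x = 0.
Proof.
set r := dot z x; set q := dot z z => xz.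
have q0 : 0 <= q by exact: dot_ge0.
(* The quadratic [2 r t + q t^2] is least at [- r / q]; [q + 1] also covers [z = 0], and the value
   is still negative unless [r = 0]. *)
have := xz (- r / (q + 1)); rewrite !dotE (dotC x z) -/r -/q -subr_ge0.
rewrite (_ : _ - _ = - (r ^+ 2 * ((q + 2) / (q + 1) ^+ 2))); last first.
  by field; rewrite gt_eqF// ltr_wpDl.
rewrite oppr_ge0 pmulr_lle0; last first.
  by rewrite divr_gt0 ?exprn_gt0// ltr_wpDl.
by move=> r0; apply/eqP; rewrite -sqrf_eq0 eq_le r0 sqr_ge0.
Qed.

End dot_product.

Lemma pos_comb_fin_or_pinfty {R : realType} (t s : R) (x y : \bar R) :
  0 < t -> 0 < s -> x != -oo%E -> y != -oo%E ->
  (t%:E * x + s%:E * y = +oo)%E \/ exists a b, x = a%:E /\ y = b%:E.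
Proof.
move=> t0 s0; case: x y => [a| |] [b| |]//= _ _; last 1 first.
- by left; rewrite !gt0_muley.
- by right; exists a, b.
- by left; rewrite gt0_muley// -EFinM addey.
- by left; rewrite gt0_muley// -EFinM addye.
Qed.

(** * Minimisers of strongly midconvex functions *)

Section strongly_midconvex.
Context {R : realType} {H : normedModType R}.
Local Open Scope ereal_scope.

Definition strongly_midconvex (c : R) (F : H -> \bar R) := forall x y : H,
  F (2^-1 *: (x + y)) + (c * `|x - y| ^+ 2)%:E <=
  (2^-1)%:E * F x + (2^-1)%:E * F y.

(** The lower bound [i] applies at the midpoint and so forces near-minimisers to be close. Taking
    [s = i] gives uniqueness of minimisers, and [s] near [i] the Cauchy property. *)
Lemma strongly_midconvex_le c F (i s : R) (x y : H) :
  strongly_midconvex c F -> (forall z, i%:E <= F z) ->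
  F x <= s%:E -> F y <= s%:E -> (c * `|x - y| ^+ 2 <= s - i)%R.
Proof.
move=> /(_ x y) Fxy iF Fx Fy.
have /(le_trans Fxy) : (2^-1)%:E * F x + (2^-1)%:E * F y <= s%:E.
  rewrite (_ : s = 2^-1 * s + 2^-1 * s)%R; last by field.
  by rewrite EFinD !EFinM leeD// lee_pmul2l// lte_fin invr_gt0.
move=> /(le_trans (leeD2r _ (iF _))).
by rewrite -EFinD lee_fin; lra.
Qed.

Lemma argmin_uniq c F (x y : H) : (0 < c)%R -> strongly_midconvex c F ->
  eproper F -> argmin F x -> argmin F y -> x = y.
Proof.
move=> c0 Fc [FNy [x0 Fx0]] Fx Fy.
have Fxfin : F x \is a fin_num.
  by rewrite fin_numE FNy/= -ltey (le_lt_trans (Fx x0))// ltey.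
have := strongly_midconvex_le _ _ (fine (F x)) (fine (F x)) x y Fc.
rewrite fineK// subrr => /(_ Fx (lexx _) (Fy _)).
rewrite pmulr_rle0// => xy0; apply/subr0_eq/normr0_eq0/eqP.
by rewrite -sqrf_eq0 eq_le xy0 sqr_ge0.
Qed.

End strongly_midconvex.

Lemma lte_EFin_dense {R : realType} (a : R) (x : \bar R) : (a%:E < x)%E ->
  exists2 d, a < d & (d%:E < x)%E.
Proof.
case: x => [r| |]//; first rewrite lte_fin => ar.
  by exists ((a + r) / 2); rewrite ?lte_fin; lra.
by exists (a + 1); rewrite ?ltry// ltrDl.
Qed.

(** The sublevel sets [S e] just above the infimum generate a Cauchy filter, and lower
    semicontinuity makes its limit a minimiser. *)
Lemma argmin_exists {R : realType} {H : normedModType R} (c b : R)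
    (F : H -> \bar R) :
  (forall G : set_system H, ProperFilter G -> cauchy G -> cvg G) ->
  0 < c -> strongly_midconvex c F ->
  lower_semicontinuous F -> eproper F -> (forall x, (b%:E <= F x)%E) ->
  exists p, argmin F p.
Proof.
move=> complete c0 Fc Flsc [FNy [x0 Fx0]] bF.
pose I := ereal_inf (range F).
have IF x : (I <= F x)%E by apply: ereal_inf_lbound; exists x.
have Ifin : I \is a fin_num.
  rewrite fin_numElt (lt_le_trans (ltNyr b))/=; last first.
    by apply: le_ereal_inf_tmp => _ [x _ <-].
  by rewrite (le_lt_trans (IF x0))// ltey.
have sub_ex e : 0 < e -> exists x, (F x < I + e%:E)%E.
  by move=> e0; have [_ [x _ <-] Fx] := lb_ereal_inf_adherent e0 Ifin; exists x.
pose S (e : R) := [set x | (F x < I + e%:E)%E].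
pose G := filter_from [set e : R | 0 < e] S.
have SS e d : e <= d -> S e `<=` S d.
  by move=> ed x /= /lt_le_trans; apply; rewrite leeD2l.
have GF : ProperFilter G.
  apply: filter_from_proper => [|e /sub_ex//].
  apply: filter_from_filter; first by exists 1 => /=.
  move=> d e /= d0 e0; exists (Num.min d e); first by rewrite /= lt_min d0.
  by rewrite subsetI; split; apply: SS; rewrite ge_min lexx ?orbT.
have : cauchy_ex G.
  move=> e e0; have ce : 0 < c * e ^+ 2 by rewrite mulr_gt0// exprn_gt0.
  have [x Fx] := sub_ex _ ce; exists x; exists (c * e ^+ 2) => // y Fy.
  rewrite -ball_normE /ball_ /=.
  (* Balls are open, so a strict bound is required: [d] is the larger of the excesses of [F x] and
     [F y] over [I]. *)
  have [d [de Fxd Fyd]] : exists d, [/\ d < c * e ^+ 2,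
      (F x <= (fine I + d)%:E)%E & (F y <= (fine I + d)%:E)%E].
    have fin z : (F z < I + (c * e ^+ 2)%:E)%E -> F z \is a fin_num.
      move=> /lt_trans Fz; rewrite fin_numE FNy/= -ltey Fz//.
      by rewrite -(fineK Ifin) -EFinD ltry.
    have := Fx; have := Fy; move: Fx Fy => /fin fx /fin fy.
    rewrite /S /= -(fineK fx) -(fineK fy) -(fineK Ifin) -EFinD !lte_fin => Fy Fx.
    exists (Num.max (fine (F x)) (fine (F y)) - fine I); split.
    - by rewrite ltrBlDl gt_max Fx Fy.
    - by rewrite lee_fin addrC subrK le_max lexx.
    - by rewrite lee_fin addrC subrK le_max lexx orbT.
  have := strongly_midconvex_le _ _ (fine I) _ _ _ Fc _ Fxd Fyd.
  rewrite fineK// => /(_ IF); rewrite addrAC subrr add0r => /le_lt_trans /(_ de).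
  by rewrite ltr_pM2l// ltr_pXn2r// nnegrE// ltW.
move=> /cauchy_exP /complete /cvg_ex[p Gp]; exists p.
suff Fp : (F p <= I)%E by move=> x; exact: le_trans (IF x).
rewrite leNgt; apply/negP => Ip.
have [a Ia aF] : exists2 a, fine I < a & (a%:E < F p)%E.
  by apply: lte_EFin_dense; rewrite fineK.
have [B pB aB] := Flsc _ _ aF.
have [e /= e0 SB] := Gp _ pB.
have me : 0 < Num.min e (a - fine I) by rewrite lt_min e0 subr_gt0.
have [x Fx] := sub_ex _ me.
have /aB : B x by apply: SB; apply: SS Fx; rewrite ge_min lexx.
apply/negP; rewrite -leNgt ltW// (lt_le_trans Fx)//.
by rewrite -(fineK Ifin) -EFinD lee_fin -lerBrDl ge_min lexx orbT.
Qed.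

(** * Semicontinuity and lower bounds for convex functions *)

Lemma lsc_addr_near {T : topologicalType} {R : realType} {I : Type}
    (F : set_system I) {FF : Filter F} (g : T -> \bar R) (f : I -> T)
    (r : I -> R) (x : T) (l c : R) : lower_semicontinuous g ->
  f i @[i --> F] --> x -> r i @[i --> F] --> l ->
  (c%:E < g x + l%:E)%E -> \forall i \near F, (c%:E < g (f i) + (r i)%:E)%E.
Proof.
move=> glsc fx rl cgx.
have [d cd dg] : exists2 d, c - l < d & (d%:E < g x)%E.
  by apply: lte_EFin_dense; rewrite EFinB lteBlDr.
have [B xB dB] := glsc _ _ dg.
have cdl : c - d < l by lra.
near=> i.
have gi : (d%:E < g (f i))%E by apply: dB; near: i; exact: fx.
have ri : c - d < r i by near: i; exact: (cvgr_gt l rl).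
case: (g (f i)) gi => [s| |]//=; last by rewrite addye// !ltry.
by rewrite -EFinD !lte_fin => ds; lra.
Unshelve. all: by end_near. Qed.

(** Lower semicontinuity gives [g > r0 - 1] on a ball around a point [x0] with finite value [r0].
    Convexity carries this to a distant [u]: a descent from [x0] to [u] steeper than [1 / d] would
    bring [g] below [r0 - 1] at distance [d] from [x0]. *)
Lemma econvex_affine_minorant {R : realType} {H : normedModType R}
    (g : H -> \bar R) : eproper g -> econvex g -> lower_semicontinuous g ->
  exists a k : R, 0 <= k /\ forall u, ((a - k * `|u|)%:E <= g u)%E.
Proof.
move=> [gNy [x0 gx0]] gcvx glsc.
have [r0 gx0E] : exists r0, g x0 = r0%:E.
  by case: (g x0) (gNy x0) gx0 => // r _ _; exists r.
have [B /nbhs_ballP[e /= e0 eB] gB] : exists2 B, nbhs x0 B &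
    forall y, B y -> ((r0 - 1)%:E < g y)%E.
  by apply: glsc; rewrite gx0E lte_fin; lra.
pose d := e / 2.
have d0 : 0 < d by rewrite divr_gt0.
exists (r0 - 1 - `|x0| / d), d^-1; split; first by rewrite invr_ge0 ltW.
move=> u; apply: (@le_trans _ _ (r0 - 1 - `|u - x0| / d)%:E).
  rewrite lee_fin -addrA lerD2l -opprD lerN2 [d^-1 * _]mulrC -mulrDl.
  by rewrite ler_pM2r ?invr_gt0// [leRHS]addrC ler_normB.
have [us|us] := leP `|u - x0| d.
  apply: (@le_trans _ _ (r0 - 1)%:E).
    by rewrite lee_fin lerBlDr lerDl divr_ge0// ltW.
  apply/ltW/gB/eB; rewrite -ball_normE /ball_ /= distrC (le_lt_trans us)//.
  by rewrite /d; lra.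
set s := `|u - x0|; have s0 : 0 < s by exact: lt_trans us.
pose t := d / s.
have t0 : 0 < t by rewrite divr_gt0.
have t1 : t <= 1 by rewrite ler_pdivrMr// mul1r ltW.
have /gB : B (t *: u + (1 - t) *: x0).
  apply: eB; rewrite -ball_normE /ball_ /=.
  have -> : x0 - (t *: u + (1 - t) *: x0) = - (t *: (u - x0)).
    by rewrite scalerBl scale1r addrCA opprD addNKr -scalerBr.
  rewrite normrN normrZ gtr0_norm// /t -mulrA mulVf ?gt_eqF// mulr1.
  by rewrite /d; lra.
have t01 : 0 <= t <= 1 by rewrite ltW.
move=> /lt_le_trans /(_ (gcvx u x0 t t01)); rewrite gx0E.
case: (g u) (gNy u) => [r| |]//= _; last by rewrite leey.
rewrite -!EFinM -EFinD lte_fin lee_fin => rt.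
have : -1 < t * (r - r0) by lra.
rewrite mulrC -ltr_pdivrMr// => tr.
have -> : s / d = 1 / t by rewrite /t; field; rewrite !gt_eqF.
lra.
Qed.

(** Completing the square absorbs a linear loss of slope [k + 1] in [|u - y|]. The extra unit
    survives as [|u - y|] and makes the bound coercive in [u], uniformly for bounded [y]. *)
Lemma econvex_quadratic_minorant {R : realType} {H : normedModType R}
    (g : H -> \bar R) (K : R) : 0 < K ->
  eproper g -> econvex g -> lower_semicontinuous g ->
  exists a k : R, 0 <= k /\ forall u y,
    ((a - k * `|y| + `|u - y|)%:E <= g u + (K * `|u - y| ^+ 2)%:E)%E.
Proof.
move=> K0 gp gc gl; have [a [k [k0 ag]]] := econvex_affine_minorant _ gp gc gl.
exists (a - (k + 1) ^+ 2 / (4 * K)), k; split => // u y.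
apply: le_trans (leeD2r _ (ag u)); rewrite -EFinD lee_fin.
set s := `|u - y|.
have uy : `|u| <= s + `|y| by rewrite -{1}(subrK y u) ler_normD.
have ku : k * `|u| <= k * (s + `|y|) by rewrite ler_wpM2l.
suff : 0 <= K * s ^+ 2 - (k + 1) * s + (k + 1) ^+ 2 / (4 * K) by lra.
have -> : K * s ^+ 2 - (k + 1) * s + (k + 1) ^+ 2 / (4 * K) =
    K * (s - (k + 1) / (2 * K)) ^+ 2 by field; rewrite gt_eqF.
by rewrite mulr_ge0 ?sqr_ge0// ltW.
Qed.

(** The parallelogram law gives the modulus [K / 4] for [dot]; it passes to any norm dominated by
    [dot], such as the sup norm on R^m. *)
Lemma econvex_quadratic_midconvex {R : realType} {H : normedModType R}
    (dot : {dot H for idfun}) (g : H -> \bar R) (K : R) (y : H) :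
  (forall x, `|x| ^+ 2 <= dot x x) -> 0 < K -> eproper g -> econvex g ->
  strongly_midconvex (K / 4)
    (fun u => g u + (K * dot (u - y) (u - y))%:E)%E.
Proof.
move=> le_norm_dot K0 [gNy _] gcvx u v.
have half0 : 0 < (2^-1 : R) by rewrite invr_gt0.
pose F u := (g u + (K * dot (u - y) (u - y))%:E)%E.
have FNy w : F w != -oo%E by rewrite /F; case: (g w) (gNy w).
have gfin w c : F w = c%:E -> exists r, g w = r%:E.
  by rewrite /F; case: (g w) (gNy w) => // r; exists r.
rewrite -/(F u) -/(F v).
have [->|[_ [_ [/gfin[ru gu] /gfin[rv gv]]]]] :=
    pos_comb_fin_or_pinfty _ _ _ _ half0 half0 (FNy u) (FNy v).
  by rewrite leey.
have half01 : 0 <= (2^-1 : R) <= 1 by lra.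
have := gcvx u v 2^-1 half01; rewrite /F.
rewrite (_ : 1 - 2^-1 = 2^-1) -?scalerDr; last by field.
rewrite gu gv.
case: (g _) => [r| |]//=; last by rewrite !addNye !leNye.
rewrite -!EFinD !lee_fin => guv.
have := dot_parallelogram dot u v y.
have : K * `|u - v| ^+ 2 <= K * dot (u - v) (u - v).
  by rewrite ler_wpM2l// ltW.
nra.
Qed.

(** * The Euclidean product and the sup norm *)

Section eucl_topology.
Context {R : realType} {m : nat}.
Implicit Types u v : 'rV[R]_m.

Lemma le_norm_eucl u : `|u| ^+ 2 <= eucl u u.
Proof.
have [u0|/mx_norm_neq0[[i j] uij]] := eqVneq (mx_norm u) 0.
  by rewrite (_ : `|u| = 0)// expr0n; exact: (dot_ge0 eucl).
rewrite (_ : `|u| = `|u i j|)// (ord1 i) real_normK ?num_real//.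
rewrite /eucl (bigD1 j)//= -expr2.
by rewrite lerDl sumr_ge0// => k _; rewrite -expr2 sqr_ge0.
Qed.

Lemma cvg_eucl {T : Type} (F : set_system T) {FF : Filter F}
    (f h : T -> 'rV[R]_m) u v :
  f x @[x --> F] --> u -> h x @[x --> F] --> v ->
  eucl (f x) (h x) @[x --> F] --> eucl u v.
Proof.
move=> fu hv; rewrite /eucl; elim: (index_enum _) => [|i s IHs].
  by under eq_fun do rewrite big_nil; rewrite big_nil; exact: cvg_cst.
under eq_fun do rewrite big_cons; rewrite big_cons; apply: cvgD => //.
apply: cvgM.
- exact: (cvg_comp _ _ fu (@coord_continuous R 1 m 0 i u)).
- exact: (cvg_comp _ _ hv (@coord_continuous R 1 m 0 i v)).
Qed.

End eucl_topology.

(** * Scaled isometries: adjoint and projection onto the range *)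

(* [ip] stands for [eucl]; keeping it abstract prevents [eucl] from being unfolded
   to its underlying function when the bilinearity lemmas are used for rewriting. *)
Section scaled_isometry.
Context {R : realType} {V : completeNormedModType R} {dot : {dot V for idfun}}.
Context (norm_dot : forall x : V, `|x| ^+ 2 = dot x x).
Context {m : nat} {ip : {dot 'rV[R]_m for idfun}}.
Context (le_norm_ip : forall u, `|u| ^+ 2 <= ip u u).
Context (cvg_ip : forall (T : Type) (F : set_system T), Filter F ->
  forall (f h : T -> 'rV[R]_m) u v,
  f x @[x --> F] --> u -> h x @[x --> F] --> v ->
  ip (f x) (h x) @[x --> F] --> ip u v).
Context {A : {linear V -> 'rV[R]_m}} {alpha : R} (alpha_gt0 : 0 < alpha).
Context (AE : forall x y, ip (A x) (A y) = alpha * dot x y).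

Local Notation adj := (adjoint dot ip A).

Lemma scaled_isometry_continuous : continuous A.
Proof.
apply/linear_bounded_continuous/linear_boundedP.
near=> r => x.
(* [alpha + 1] stands in for the square root of [alpha]: it ensures [alpha <= r ^+ 2]. *)
have r1 : alpha + 1 <= r by near: r; apply: nbhs_pinfty_ge; rewrite num_real.
have r0 : 0 <= r by apply: le_trans r1; rewrite addr_ge0// ltW.
rewrite -(@ler_pXn2r _ 2)// ?nnegrE ?mulr_ge0// exprMn.
rewrite (le_trans (le_norm_ip _))// AE norm_dot ler_wpM2r ?dot_ge0//.
by nra.
Unshelve. all: by end_near. Qed.

Lemma cvgA (T : Type) (F : set_system T) (f : T -> V) x : Filter F ->
  f i @[i --> F] --> x -> A (f i) @[i --> F] --> A x.
Proof. by move=> FF fx; apply: cvg_comp fx (scaled_isometry_continuous x). Qed.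

(** The default value of [adjoint] is ruled out by a construction: if [p] minimises [|A v - u|^2],
    then [A p - u] is orthogonal to the range, so by [AE] the vector [alpha *: p] is the adjoint of
    [A] at [u]. *)
Lemma adjointP u z : ip (A z) u = dot z (adj u).
Proof.
move: z; apply: (@xgetPex _ 0 [set v | forall z, ip (A z) u = dot z v]).
pose F v := (ip (A v - u) (A v - u))%:E.
have [p pF] : exists p, argmin F p.
  apply: (@argmin_exists _ _ (alpha / 4) 0 F).
  - exact: cauchy_cvg.
  - by rewrite divr_gt0.
  - move=> x y; rewrite /F -!EFinM -!EFinD lee_fin (linearZZ A) (linearD A).
    rewrite -(dot_parallelogram ip) lerD2l norm_dot -(linearB A) AE.
    by rewrite mulrA (mulrC 4^-1).
  - move=> x a; rewrite /F lte_fin => ax.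
    exists [set y | (a%:E < F y)%E] => //; apply: (cvgr_gt _ _ _ ax).
    have Axu : A y - u @[y --> x] --> A x - u.
      by apply: cvgB; [apply: cvgA|exact: cvg_cst].
    exact: cvg_ip.
  - by split => //; exists 0.
  - by move=> x; rewrite lee_fin dot_ge0.
exists (alpha *: p) => z /=; rewrite dotZr -AE.
apply/subr0_eq/oppr_inj; rewrite opprB oppr0 -dotNr -dotDr.
apply: dot_stationary => t; have := pF (p + t *: z).
by rewrite /F lee_fin (linearD A) (linearZZ A) addrAC.
Qed.

Lemma adjoint_uniq u v : (forall z, ip (A z) u = dot z v) -> adj u = v.
Proof. by move=> uv; apply: (dot_inj dot) => z; rewrite -adjointP. Qed.

Lemma orthoproj_range u : orthoproj ip (range A) u = alpha^-1 *: A (adj u).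
Proof.
have ort z : ip (u - alpha^-1 *: A (adj u)) (A z) = 0.
  rewrite dotDl dotNl dotZl dotC adjointP AE mulKf ?gt_eqF//.
  by rewrite (dotC dot) subrr.
apply: xget_unique => [|_ [[y _ <-] uy]].
  split=> [|_ [z _ <-]//]; exists (alpha^-1 *: adj u) => //.
  by rewrite (linearZZ A).
have -> : adj u = alpha *: y; last by rewrite (linearZZ A) scalerK ?gt_eqF.
apply: adjoint_uniq => z; rewrite dotZr -AE; apply/subr0_eq.
by rewrite -dotNr -dotDr dotC uy//; exists z.
Qed.

(** This yields the first claim of the theorem: the projection is [A A^T / alpha], and
    [A^T A = alpha Id]. *)
Lemma adjoint_orthoproj u : adj (orthoproj ip (range A) u) = adj u.
Proof.
apply: adjoint_uniq => z.
by rewrite orthoproj_range dotZr AE mulKf ?gt_eqF.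
Qed.

(** * The function whose proximal operator is the approximal operator *)

Section envelope.
Context {g : 'rV[R]_m -> \bar R}.
Context (g_proper : eproper g) (g_convex : econvex g).
Context (g_lsc : lower_semicontinuous g).

(** With this constant [penalty y] is the objective of [prox_{alpha g}] at [y] divided by [alpha],
    which has the same minimisers. *)
Let K := (2 * alpha)^-1.
Let K0 : 0 < K. Proof. by rewrite invr_gt0 mulr_gt0. Qed.

Local Notation penalty y := (fun u => g u + (K * ip (u - y) (u - y))%:E)%E.

Lemma penalty_minorant : exists a k : R, 0 <= k /\ forall u y,
  ((a - k * `|y| + `|u - y|)%:E <= penalty y u)%E.
Proof.
have [a [k [k0 ak]]] := econvex_quadratic_minorant g K K0 g_proper g_convex g_lsc.
exists a, k; split => // u y; apply: le_trans (ak u y) _.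
by rewrite leeD2l// lee_fin ler_wpM2l// ltW.
Qed.

Lemma cvg_penalty (T : Type) (F : set_system T) (f h : T -> 'rV[R]_m)
    (u y : 'rV[R]_m) :
  Filter F -> f x @[x --> F] --> u -> h x @[x --> F] --> y ->
  K * ip (f x - h x) (f x - h x) @[x --> F] --> K * ip (u - y) (u - y).
Proof.
move=> FF fu hy; have fhu : f x - h x @[x --> F] --> u - y by exact: cvgB.
by apply: cvgM; [exact: cvg_cst|exact: cvg_ip].
Qed.

Lemma prox_penalty_exists y : exists p, argmin (penalty y) p.
Proof.
have [a [k [k0 ak]]] := penalty_minorant.
have [gNy [x0 gx0]] := g_proper.
apply: (@argmin_exists _ _ (K / 4) (a - k * `|y|)).
- exact: cauchy_cvg.
- by rewrite divr_gt0.
- exact: econvex_quadratic_midconvex.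
- move=> u c cu.
  exists [set v | (c%:E < penalty y v)%E] => //.
  have Fu : Filter (nbhs u) by exact: nbhs_filter.
  have q := cvg_penalty _ (nbhs u) id (fun=> y) u y Fu (@cvg_id _ _)
    (@cvg_cst _ y _ _ Fu).
  exact: (@lsc_addr_near _ _ _ (nbhs u) Fu g id _ u _ c g_lsc (@cvg_id _ _) q cu).
- split => [u|]; first by case: (g u) (gNy u).
  by exists x0; case: (g x0) (gNy x0) gx0.
- by move=> u; apply: le_trans (ak u y); rewrite lee_fin lerDl.
Qed.

Lemma prox_penalty y :
  argmin (penalty y) (prox ip (fun z => alpha%:E * g z)%E y).
Proof.
have argminE : argmin (penalty y) = argmin (fun u =>
    alpha%:E * g u + (2^-1 * ip (u - y) (u - y))%:E)%E.
  have scaleE u : (alpha%:E * g u + (2^-1 * ip (u - y) (u - y))%:E =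
      alpha%:E * (penalty y u))%E.
    rewrite muleDr ?fin_num_adde_defl// -EFinM mulrA; congr (_ + (_ * _)%:E)%E.
    by rewrite /K; field; rewrite gt_eqF.
  by apply/seteqP; split => p pmin u; have := pmin u; rewrite !scaleE lee_pmul2l.
rewrite argminE; apply: (@xgetPex _ 0 (argmin _)).
by rewrite -argminE; exact: prox_penalty_exists.
Qed.

(* By [adjointP] and [AE], these are the [u] with [adj u = alpha *: v]. *)
Definition fiber v := [set u | forall z, ip (A z) (u - A v) = 0].

Lemma fiber_pythagoras v u x : fiber v u ->
  ip (u - A x) (u - A x) = ip (u - A v) (u - A v) + alpha * dot (v - x) (v - x).
Proof.
move=> uv; have -> : u - A x = (u - A v) + A (v - x).
  by rewrite (linearB A) addrA subrK.
by rewrite dot_pythagoras ?AE// dotC uv.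
Qed.

Lemma fiber_adjoint u : fiber (alpha^-1 *: adj u) u.
Proof.
by move=> z; rewrite dotDr dotNr AE dotZr mulVKf ?gt_eqF// adjointP subrr.
Qed.

Definition envelope v := ereal_inf (penalty (A v) @` fiber v).

Lemma envelope_le v u : fiber v u -> (envelope v <= penalty (A v) u)%E.
Proof. by move=> uv; apply: ereal_inf_lbound; exists u. Qed.

Lemma le_envelope v c : (forall u, fiber v u -> c <= penalty (A v) u)%E ->
  (c <= envelope v)%E.
Proof. by move=> cu; apply: le_ereal_inf_tmp => _ [u uv <-]; exact: cu. Qed.

Lemma envelope_proper : eproper envelope.
Proof.
split=> [v|].
  have [a [k [k0 ak]]] := penalty_minorant.
  have : ((a - k * `|A v|)%:E <= envelope v)%E.
    by apply: le_envelope => u _; apply: le_trans (ak _ _); rewrite lee_fin lerDl.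
  by case: (envelope v).
have [gNy [u gu]] := g_proper; exists (alpha^-1 *: adj u).
have := envelope_le _ _ (fiber_adjoint u).
by case: (g u) (gNy u) gu; case: (envelope _).
Qed.

Lemma envelope_convex : econvex envelope.
Proof.
(* The endpoints are treated apart: there a zero weight may multiply [+oo]. *)
move=> x y t /andP[]; rewrite le_eqVlt => /predU1P[<- _|t0].
  by rewrite scale0r add0r subr0 scale1r mul0e add0e mul1e.
rewrite le_eqVlt => /predU1P[->|t1].
  by rewrite subrr scale0r addr0 scale1r mul0e adde0 mul1e.
have t01 : 0 <= t <= 1 by rewrite !ltW.
have t1' : 0 < 1 - t by rewrite subr_gt0.
have [phiNy _] := envelope_proper.
have [->|[a [b [xa yb]]]] :=
    pos_comb_fin_or_pinfty _ _ _ _ t0 t1' (phiNy x) (phiNy y).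
  by rewrite leey.
apply/lee_addgt0Pr => e e0.
have near_inf v c : envelope v = c%:E -> exists2 u, fiber v u &
    exists2 r, g u = r%:E & r + K * ip (u - A v) (u - A v) <= c + e.
  move=> vc; have vfin : envelope v \is a fin_num by rewrite vc.
  have [_ [u uv <-]] := lb_ereal_inf_adherent e0 vfin.
  rewrite -/(envelope v) vc; case: g_proper => /(_ u) gNy _ ue; exists u => //.
  move: gNy ue; case: (g u) => // r _; rewrite -!EFinD lte_fin => ue.
  by exists r => //; exact: ltW.
have [u ux [r gu ru]] := near_inf _ _ xa.
have [v vy [s gv sv]] := near_inf _ _ yb.
(* The fiber condition is linear in base point and [u] jointly, so combining the two near-minimisers
   gives a point of the fiber over [z]. *)
pose w := t *: u + (1 - t) *: v; pose z := t *: x + (1 - t) *: y.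
have wz : w - A z = t *: (u - A x) + (1 - t) *: (v - A y).
  rewrite /w /z (linearD A) !(linearZZ A) !scalerBr opprD.
  by rewrite addrACA.
have fw : fiber z w by move=> p; rewrite wz dotDr !dotZr ux vy !mulr0 addr0.
apply: le_trans (envelope_le _ _ fw) _.
apply: le_trans (leeD2r _ (g_convex u v t t01)) _.
rewrite gu gv xa yb -!EFinD lee_fin wz.
have := dot_convex ip (u - A x) (v - A y) t t01.
move=> /(ler_wpM2l (ltW K0)).
nra.
Qed.

(** For [w] near [v], the penalty must exceed [c] on the whole fiber over [w]. Coercivity settles
    large [u]; on a ball, compactness reduces the claim to a neighbourhood of each [(u, v)]. *)
Lemma envelope_lsc : lower_semicontinuous envelope.
Proof.
(* An infimum of values above [c] is only at least [c], hence the room left between [b] and [c]. *)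
move=> v b /lte_EFin_dense[c bc cv].
exists [set w | (b%:E < envelope w)%E] => //.
have [a [k [k0 ak]]] := penalty_minorant.
(* If [|A w| <= Y] and [|u| > M], then [|u - A w| > M - Y = c - a + k Y], and [penalty_minorant]
   puts the penalty above [c]. *)
pose Y := `|A v| + 1; pose M := c - a + k * Y + Y.
have Mcompact : compact [set u : 'rV[R]_m | `|u| <= M].
  apply: bounded_closed_compact.
    exists M; split => [|N MN u /= /le_trans]; first exact: num_real.
    by apply; exact: ltW.
  have := @closed_closed_ball_ R 'rV[R]_m 0 M.
  congr closed; apply/seteqP.
  by split => u /=; rewrite /closed_ball_/= sub0r normrN.
pose P w u := fiber w u -> (c%:E < penalty (A w) u)%E.
have near_compact : \forall w \near v, [set u : 'rV[R]_m | `|u| <= M] `<=` P w.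
  apply: (iffLR (compact_near_coveringP _) Mcompact) => u _.
  pose G := filter_prod (nbhs u) (nbhs v).
  have GF : Filter G by exact: filter_prod_filter.
  have fst_u : z.1 @[z --> G] --> u by exact: cvg_fst.
  have snd_v : A z.2 @[z --> G] --> A v by apply: cvgA; exact: cvg_snd.
  (* On the fiber, the penalty exceeds [c] at [(u, v)], hence nearby. *)
  have [uv|] := pselect (fiber v u).
    have cu := lt_le_trans cv (envelope_le _ _ uv).
    have q := @cvg_penalty _ G fst (A \o snd) u (A v) GF fst_u snd_v.
    have := @lsc_addr_near _ _ _ G GF g fst _ u _ c g_lsc fst_u q cu.
    by apply: filterS => -[u' w] /= uw _.
  (* Off the fiber, some orthogonality relation fails at [(u, v)]; it still fails nearby, so [P]
     holds vacuously there. *)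
  move=> /existsNP[z /eqP uvz].
  have zG : A z @[_ --> G] --> A z by exact: cvg_cst.
  have subG : p.1 - A p.2 @[p --> G] --> u - A v by exact: cvgB.
  have ipG := @cvg_ip _ G GF _ _ _ _ zG subG.
  apply: filterS (cvgr_neq0 _ ipG uvz) => -[u' w] /= uwz /(_ z) uw0.
  by rewrite uw0 eqxx in uwz.
have near_Y : \forall w \near v, `|A w| <= Y.
  have : `|A w| @[w --> v] --> `|A v| by apply: cvg_norm; apply: cvgA.
  by move=> /cvgr_le; apply; rewrite ltrDl.
near=> w => /=; apply: (@lt_le_trans _ _ c%:E); first by rewrite lte_fin.
apply: le_envelope => u wu.
have [uM|uM] := leP `|u| M.
  by apply: ltW; move: wu; move: u uM; near: w; exact: near_compact.
have wY : `|A w| <= Y by near: w.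
apply: le_trans (ak u (A w)); rewrite lee_fin.
have : k * `|A w| <= k * Y by rewrite ler_wpM2l.
have : `|u| <= `|u - A w| + `|A w| by rewrite -{1}(subrK (A w) u) ler_normD.
by move: uM; rewrite /M; lra.
Unshelve. all: by end_near. Qed.

Lemma prox_envelope x :
  prox dot envelope x =
  alpha^-1 *: adj (prox ip (fun z => alpha%:E * g z)%E (A x)).
Proof.
set u := prox ip _ _; set v := alpha^-1 *: adj u.
have [phiNy [w phiw]] := envelope_proper.
pose F w := (envelope w + (2^-1 * dot (w - x) (w - x))%:E)%E.
(* As [K * alpha = 1/2], Pythagoras merges the two quadratic terms, so minimising over [w'] and its
   fiber amounts to minimising [penalty (A x)] over all [u']. *)
have Fpenalty w' u' : fiber w' u' ->
    (penalty (A w') u' + (2^-1 * dot (w' - x) (w' - x))%:E = penalty (A x) u')%E.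
  move=> wu'; rewrite (fiber_pythagoras _ _ x wu') -addeA -EFinD mulrDr.
  by congr (_ + (_ + _)%:E)%E; rewrite /K; field; rewrite gt_eqF.
have vmin : argmin F v.
  move=> w'; apply: (@le_trans _ _ (penalty (A x) u)).
    have vu := fiber_adjoint u.
    by rewrite -(Fpenalty v u vu) leeD2r// envelope_le.
  rewrite -leeBlDr//; apply: le_envelope => u' wu'.
  by rewrite leeBlDr// Fpenalty//; exact: prox_penalty.
have Fproper : eproper F.
  split=> [w'|]; first by rewrite /F; case: (envelope w') (phiNy w').
  by exists w; rewrite /F; case: (envelope w) (phiNy w) phiw.
have Fmid : strongly_midconvex (2^-1 / 4) F.
  apply: econvex_quadratic_midconvex => //.
  - by move=> y; rewrite norm_dot.
  - exact: envelope_proper.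
  - exact: envelope_convex.
(* [xget] picks an arbitrary minimiser, so [v] has to be the only one; the modulus comes from the
   term [dot (w - x) (w - x) / 2]. *)
apply: xget_unique => // w' wmin.
by apply: (argmin_uniq (2^-1 / 4) F) => //; rewrite divr_gt0// invr_gt0.
Qed.

End envelope.

End scaled_isometry.

Theorem lemma3 (R : realType) (V : completeNormedModType R)
    (dot : {dot V for idfun}) (norm_dot : forall x : V, `|x| ^+ 2 = dot x x)
    (m : nat) (g : 'rV[R]_m -> \bar R)
    (g_proper : eproper g) (g_convex : econvex g) (g_lsc : lower_semicontinuous g)
    (A : {linear V -> 'rV[R]_m}) (alpha : R) (alpha_gt0 : 0 < alpha)
    (AtA : forall x : V, adjoint dot eucl A (A x) = alpha *: x) :
  (forall x : V, approximal dot A alpha g x =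
     alpha^-1 *: adjoint dot eucl A
       (prox eucl (fun z => alpha%:E * g z)%E (A x))) /\
  (exists phi : V -> \bar R,
     [/\ eproper phi, econvex phi, lower_semicontinuous phi &
         approximal dot A alpha g = prox dot phi]).
Proof.
have cvg_ip := @cvg_eucl R m.
have AE (x y : V) : eucl (A x) (A y) = alpha * dot x y.
  (* For [y != 0], if no vector represented the adjoint at [A y], then [AtA] would equate the
     default value 0 with [alpha *: y]. *)
  have [->|y0] := eqVneq y 0.
    by rewrite (linear0 A) (linear0r eucl) (linear0r dot) mulr0.
  pose adjset := [set v | forall z, eucl (A z) (A y) = dot z v].
  have [adjy|noadj] := pselect (exists v, adjset v).
    have := xgetPex 0 adjy x; rewrite -/(adjoint dot eucl A (A y)) AtA.
    by rewrite dotZr.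
  have := AtA y; rewrite /adjoint xgetPN => [/esym/eqP|v adjv].
    by rewrite scaler_eq0 gt_eqF//= (negPf y0).
  by apply: noadj; exists v.
have approxE x : approximal dot A alpha g x = alpha^-1 *: adjoint dot eucl A
    (prox eucl (fun z => alpha%:E * g z)%E (A x)).
  rewrite /approximal.
  by rewrite (adjoint_orthoproj norm_dot le_norm_eucl cvg_ip alpha_gt0 AE).
split; first exact: approxE.
exists (envelope (ip := eucl) (A := A) (alpha := alpha) (g := g)).
split.
- exact: (envelope_proper norm_dot le_norm_eucl cvg_ip alpha_gt0 AE g_proper
    g_convex g_lsc).
- exact: (envelope_convex norm_dot le_norm_eucl cvg_ip alpha_gt0 AE g_proper
    g_convex g_lsc).
- exact: (envelope_lsc norm_dot le_norm_eucl cvg_ip alpha_gt0 AE g_proper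
    g_convex g_lsc).
- apply/funext => x; rewrite approxE; apply/esym.
  exact: (prox_envelope norm_dot le_norm_eucl cvg_ip alpha_gt0 AE g_proper
    g_convex g_lsc).
Qed.
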